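(* Let $G$ be a finitely generated group and $\Gamma$ a finite abelian group. Write $H_1(G)=\mathbb{Z}^n\oplus T$, where $T$ is finite. For each prime $p$ dividing $|\Gamma|$, let $\lambda=\pi(\Gamma_p)$ and $\tau=\pi(T_p)$ be the partitions associated to the $p$-torsion parts $\Gamma_p$ and $T_p$ of $\Gamma$ and $T$ (so $\lambda,\tau$ depend on $p$). Then $$\delta_{\Gamma}(G)=\prod_{p\,\mid\,|\Gamma|}\frac{p^{(|\lambda|-l(\lambda))n+\theta(\lambda',\tau)}\prod_{i=1}^{l(\lambda)}\left(p^{\,n+\theta_i(\lambda,\tau)-\theta_i(\lambda',\tau)}-p^{\,i-1}\right)}{p^{|\lambda|+2\langle\lambda\rangle}\prod_{k\ge 1}\varphi_{m_k(\lambda)}(p^{-1})}.$$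
   Context: For a finitely generated group $G$ and a finite group $\Gamma$, the Hall invariant is $\delta_\Gamma(G)=|\mathrm{Epi}(G,\Gamma)|/|\mathrm{Aut}(\Gamma)|$, where $\mathrm{Epi}(G,\Gamma)$ is the set of surjective homomorphisms $G\to\Gamma$. $H_1(G)$ is the abelianization of $G$. A finite abelian $p$-group $A\cong\mathbb{Z}_{p^{\pi_1}}\oplus\cdots\oplus\mathbb{Z}_{p^{\pi_r}}$ with $\pi_1\ge\cdots\ge\pi_r\ge1$ has associated partition $\pi(A)=(\pi_1,\dots,\pi_r)$ (empty if $A$ is trivial). For a partition $\pi=(\pi_1,\dots,\pi_r)$: $l(\pi)=r$ is its length, $|\pi|=\sum_{i=1}^r\pi_i$ its weight, $\langle\pi\rangle=\sum_{i=1}^r(i-1)\pi_i$, and $m_k(\pi)=\#\{j\mid\pi_j=k\}$. Also $\varphi_m(t)=\prod_{i=1}^m(1-t^i)$, with $\varphi_0=1$. Given a partition $\lambda$, $\lambda'$ denotes the sequence with $\lambda'_i=\lambda_i-1$, $1\le i\le l(\lambda)$ (this is not the conjugate partition; some $\lambda_i'$ may be $0$). For $1\le i\le l(\lambda)$ set $\theta_i(\lambda,\tau)=\sum_{j=1}^{l(\tau)}\min(\lambda_i,\tau_j)$ and $\theta_i(\lambda',\tau)=\sum_{j=1}^{l(\tau)}\min(\lambda_i-1,\tau_j)$, and $\theta(\lambda',\tau)=\sum_{i=1}^{l(\lambda)}\theta_i(\lambda',\tau)$. *)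

(* Defs.v *)
From HB Require Import structures.
From mathcomp Require Import all_boot all_order all_algebra all_fingroup all_solvable.
From mathcomp Require Import finmap boolp classical_sets functions cardinality.

Set Implicit Arguments.
Unset Strict Implicit.
Unset Printing Implicit Defensive.

Import GRing.Theory.

Section InfiniteGroups.
Local Open Scope group_scope.
Local Open Scope classical_set_scope.
Implicit Type G : groupType.
Local Notation rep := generic_quotient.repr.

Definition is_subgroup G (H : set G) : Prop :=
  [/\ H 1, forall x y, H x -> H y -> H (x * y) & forall x, H x -> H x^-1].

Definition generated_subgroup G (S : set G) : set G := smallest (@is_subgroup G) S.

Definition finitely_generated G : Prop :=
  exists s : seq G, generated_subgroup [set` s] = setT.

Definition derived_subgroup G : set G :=
  generated_subgroup [set z | exists x y : G, z = [~ x, y]].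

Lemma is_subgroup_generated G (S : set G) : is_subgroup (generated_subgroup S).
Proof.
split=> [H [[]] //|x y Sx Sy H HS|x Sx H HS]; have [[_ HM HV] _] := HS.
  by apply: HM; [apply: Sx | apply: Sy].
by apply: HV; apply: Sx.
Qed.

Lemma is_subgroup_derived G : is_subgroup (@derived_subgroup G).
Proof. exact: is_subgroup_generated. Qed.

Definition derived_rel G : rel G := fun x y => `[< derived_subgroup (x^-1 * y) >].

Fact derived_rel_equiv G : equiv_class_of (@derived_rel G).
Proof.
have [D1 DM DV] := is_subgroup_derived G.
have sym (x y : G) : derived_rel x y -> derived_rel y x.
  by move=> /asboolP Dxy; apply/asboolP; have := DV _ Dxy; rewrite invgM invgK.
split=> [x|x y|y x z /asboolP Dxy /asboolP Dyz].
- by apply/asboolP; rewrite mulVg; apply: D1.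
- by apply/idP/idP; apply: sym.
- by apply/asboolP; have := DM _ _ Dxy Dyz; rewrite mulgA mulgK.
Qed.

Canonical derived_equiv G := EquivRelPack (derived_rel_equiv G).

(* H_1(G) = G / [G, G], written additively. *)
Definition H1 G := {eq_quot @derived_rel G}%qT.

HB.instance Definition _ G := Choice.on (H1 G).
HB.instance Definition _ G := EqQuotient.on (H1 G).

Lemma derived_conj G (c x : G) : derived_subgroup c -> derived_subgroup (c ^ x).
Proof.
have [_ DM _] := is_subgroup_derived G.
move=> Dc; rewrite -[c ^ x](mulKVg c) -/([~ c, x]).
by apply: DM => //; apply: sub_gen_smallest; exists c, x.
Qed.

Lemma pi_H1_eq G (x y : G) :
  \pi_(H1 G)%qT x = \pi_(H1 G)%qT y <-> derived_subgroup (x^-1 * y).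
Proof. by split=> [/eqmodP/asboolP //|Dxy]; apply/eqmodP/asboolP. Qed.

Definition H1_zero G : H1 G := \pi%qT 1.
Definition H1_opp G (a : H1 G) : H1 G := \pi%qT (rep a)^-1.
Definition H1_add G (a b : H1 G) : H1 G := \pi%qT (rep a * rep b).

Lemma derived_comm G (x y : G) : derived_subgroup [~ x, y].
Proof. by apply: sub_gen_smallest; exists x, y. Qed.

Lemma pi_H1_mul G (x y : G) :
  H1_add (\pi_(H1 G)%qT x) (\pi_(H1 G)%qT y) = \pi_(H1 G)%qT (x * y).
Proof.
have [_ DM _] := is_subgroup_derived G.
have /pi_H1_eq Dx := reprK (\pi_(H1 G)%qT x).
have /pi_H1_eq Dy := reprK (\pi_(H1 G)%qT y).
rewrite /H1_add; apply/pi_H1_eq.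
move: (rep (\pi_(H1 G)%qT x)) (rep (\pi_(H1 G)%qT y)) Dx Dy => x' y' Dx Dy.
have -> : (x' * y')^-1 * (x * y) = (x'^-1 * x) ^ y' * (y'^-1 * y).
  by rewrite conjgE invgM !mulgA mulgK.
by apply: DM => //; apply: derived_conj.
Qed.

Lemma pi_H1_inv G (x : G) : H1_opp (\pi_(H1 G)%qT x) = \pi_(H1 G)%qT x^-1.
Proof.
have [_ _ DV] := is_subgroup_derived G.
have /pi_H1_eq Dx := reprK (\pi_(H1 G)%qT x).
rewrite /H1_opp; apply/pi_H1_eq; move: (rep _) Dx => x' Dx; rewrite invgK.
have -> : x' * x^-1 = ((x'^-1 * x)^-1) ^ x'^-1.
  by rewrite conjgE invgM !invgK mulgK.
exact: derived_conj (DV _ Dx).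
Qed.

Fact H1_addA G : associative (@H1_add G).
Proof.
elim/quotW=> x; elim/quotW=> y; elim/quotW=> z.
by rewrite [H1_add (\pi y)%qT _]pi_H1_mul [H1_add (\pi x)%qT (\pi y)%qT]pi_H1_mul !pi_H1_mul mulgA.
Qed.

Fact H1_addC G : commutative (@H1_add G).
Proof.
elim/quotW=> x; elim/quotW=> y; rewrite !pi_H1_mul; apply/pi_H1_eq.
by rewrite invgM -mulgA; have := derived_comm y x; rewrite /commg conjgE.
Qed.

Fact H1_add0 G : left_id (@H1_zero G) (@H1_add G).
Proof. by elim/quotW=> x; rewrite pi_H1_mul mul1g. Qed.

Fact H1_addN G : left_inverse (@H1_zero G) (@H1_opp G) (@H1_add G).
Proof. by elim/quotW=> x; rewrite pi_H1_inv pi_H1_mul mulVg. Qed.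

HB.instance Definition _ G :=
  GRing.isZmodule.Build (H1 G) (@H1_addA G) (@H1_addC G) (@H1_add0 G) (@H1_addN G).

Definition Epi G (Gamma : finGroupType) : set (G -> Gamma) :=
  [set f | {morph f : x y / x * y} /\ range f = setT].

End InfiniteGroups.

(* [fset_set] returns the empty set on an infinite set; Epi is finite as soon
   as G is finitely generated. *)
Definition hall_invariant (Gamma : finGroupType) (G : groupType) : rat :=
  ((#|` fset_set (@Epi G Gamma)|%fset)%:R / #|Aut [set: Gamma]|%:R)%R.

Section Partitions.

Definition torsion_part (p : nat) (gT : finGroupType) : {set gT} :=
  [set x | p.-elt x]%g.

(* For an abelian p-group A, [abelian_type A] lists p ^ pi_1, p ^ pi_2, ... in
   nonincreasing order; see ptypeP. *)
Definition ptype (p : nat) (gT : finGroupType) (A : {set gT}) : seq nat :=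
  [seq logn p m | m <- abelian_type A].

Definition part_weight (s : seq nat) : nat := sumn s.
Definition part_length (s : seq nat) : nat := size s.
Definition part_angle (s : seq nat) : nat := \sum_(i < size s) i * nth 0 s i.
Definition part_mult (k : nat) (s : seq nat) : nat := count_mem k s.
Definition part_lower (s : seq nat) : seq nat := [seq k.-1 | k <- s].

(* Rows are numbered from 0. *)
Definition theta_row (s t : seq nat) (i : nat) : nat :=
  \sum_(u <- t) minn (nth 0 s i) u.
Definition theta (s t : seq nat) : nat := \sum_(i < size s) theta_row s t i.

Local Open Scope ring_scope.

Definition varphi (m : nat) (t : rat) : rat := \prod_(1 <= i < m.+1) (1 - t ^+ i).

(* The product over k >= 1 stops at the weight since part_mult k lam = 0 beyond it.
   The truncated subtractions are exact: every part of lam is positive and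
   theta_row (part_lower lam) tau i <= theta_row lam tau i. *)
Definition hall_factor (p n : nat) (lam tau : seq nat) : rat :=
  let lam' := part_lower lam in
  (p%:R ^+ ((part_weight lam - part_length lam) * n + theta lam' tau)%N *
   \prod_(i < part_length lam)
     (p%:R ^+ (n + theta_row lam tau i - theta_row lam' tau i)%N - p%:R ^+ i)) /
  (p%:R ^+ (part_weight lam + 2 * part_angle lam)%N *
   \prod_(1 <= k < (part_weight lam).+1) varphi (part_mult k lam) (p%:R^-1)).

End Partitions.

Section PtypeCorrect.
Local Open Scope group_scope.

Lemma ptypeP (p : nat) (gT : finGroupType) (A : {group gT}) :
    prime p -> abelian A -> p.-group A ->
  [/\ sorted geq (ptype p A), all (leq 1) (ptype p A)
    & exists2 b : seq gT, \big[dprod/1]_(x <- b) <[x]> = A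
                        & [seq #[x] | x <- b] = [seq (p ^ k)%N | k <- ptype p A]].
Proof.
move=> p_pr cAA pA.
have [b defA ob] := abelian_structure cAA.
have E : [seq #[x] | x <- b] = [seq (p ^ k)%N | k <- ptype p A].
  rewrite /ptype -ob -!map_comp; apply/eq_in_map=> x bx /=.
  have : p.-nat #[x].
    apply: pnat_dvd pA; rewrite -(bigdprod_card defA) (big_rem x bx) /=.
    exact: dvdn_mulr.
  by move=> /p_natP[k ->]; rewrite pfactorK.
have gt1 := abelian_type_gt1 A; have srt := abelian_type_sorted A.
rewrite -ob E in gt1 srt; split; last by exists b.
- move: srt; rewrite sorted_map; apply: sub_sorted => m n.
  by rewrite /= leq_exp2l ?prime_gt1.
- move: gt1; rewrite all_map; apply: sub_all => k /=.
  by case: k => //; rewrite expn0.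
Qed.

End PtypeCorrect.

(* Main.v *)
Require Import Defs.
From HB Require Import structures.
From mathcomp Require Import all_boot all_order all_algebra all_fingroup all_solvable.
From mathcomp Require Import finmap boolp classical_sets functions cardinality.
From mathcomp Require Import fintype finset zify.

(** A homomorphism from [G] to the abelian group [Gamma] factors through
    [H_1(G) = Z^n + T], and even through the finite group [T x (Z/e)^n] as soon
    as [e] is a multiple of the exponent of [Gamma]; so [Epi(G, Gamma)] is
    counted by the epimorphisms of a finite group ([card_Epi_epis],
    [morph_homology_mod]).  Moreover [Aut Gamma] is counted by the
    epimorphisms from [Gamma] to itself ([card_Aut_epis]).  Hence numerator and
    denominator of the Hall invariant are both values of the same count: the
    number of epimorphisms from a finite group [A] onto a finite abelian group.

    A map to a product of groups of coprime orders is onto as soon as both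
    components are, so this count is a product over primes
    ([card_epis_primary]).  Let then [K] be an abelian [p]-group that is the
    direct product of cyclic groups of orders [p^lam_0 >= p^lam_1 >= ...], and
    let [h k] be the number of homomorphisms from [A] to the cyclic group of
    order [p^k].  The heart of the proof is
<<
      #|epis A K| = \prod_i (h lam_i - p^i * h (lam_i - 1)),
>>
    obtained by adding the cyclic factors one at a time, the smallest last
    ([card_epis_cycle]).  Suppose that [f : A -> K'] is onto and that
    [K = K' x <x>], with [K'] a product of [s] cyclic groups whose orders are
    multiples of the order of [x].  By Goursat's argument
    ([epis_mul_cycle]) a map [g : A -> <x>] fails to complete [f] to an
    epimorphism onto [K] exactly when, modulo [<x^p>], it factors through [f].
    The divisibility of the orders lets this factorization be lifted to a
    homomorphism [psi : K' -> <x>], so the bad [g] are the products of some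
    [psi o f] and some homomorphism from [A] to [<x^p>].  These products form
    the product of two subgroups of the group of all maps, of orders
    [#|<x>|^s] and [h (k - 1)] where [#[x] = p^k], meeting in a subgroup of
    order [#|<x^p>|^s]; there are thus [p^s * h (k - 1)] of them.

    It remains to insert [h k = p^(k n + \sum_j min(k, tau_j))].  For the source
    [T x (Z/e)^n] the factors become those of the numerator of the formula
    ([epi_count_numerator]).  For the source [Gamma], where [n = 0] and
    [tau = lam], the quotient [h lam_i / h (lam_i - 1)] is [p^c_i], where [c_i]
    counts the parts that are at least [lam_i].  The factors [1 - p^(i - c_i)]
    run, for the [m] values of [i] with a common [lam_i], through
    [1 - p^-1, ..., 1 - p^-m], and they multiply to the [varphi] of the
    denominator ([epi_count_denominator]). *)

Set Implicit Arguments.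
Unset Strict Implicit.
Unset Printing Implicit Defensive.

Import GRing.Theory Num.Theory.

(** * Homomorphisms between finite groups as finite functions *)

(* Homomorphisms to an abelian group form a group under pointwise product; the
   orders of its subgroups are compared below, so it has to be a finGroupType. *)
HB.instance Definition _ (aT : finType) (rT : finGroupType) :=
  Finite.on {ffun aT -> rT}.

Section Homs.
Local Open Scope group_scope.
Variables gT rT : finGroupType.

(** The value 1 outside [A] makes a homomorphism on [A] determine the finite
    function, so that cardinals count homomorphisms. *)
Definition homs (A : {set gT}) (C : {set rT}) : {set {ffun gT -> rT}} :=
  [set f : {ffun gT -> rT} | [&& [forall x in A, f x \in C],
               [forall x in A, forall y in A, f (x * y) == f x * f y]
             & [forall (x | x \notin A), f x == 1]]].

Definition epis (A : {set gT}) (C : {set rT}) : {set {ffun gT -> rT}} :=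
  [set f in homs A C | C \subset f @: A].

Lemma homsP (A : {set gT}) (C : {set rT}) (f : {ffun gT -> rT}) :
  reflect [/\ {in A, forall x, f x \in C}, {in A &, {morph f : x y / x * y}}
            & forall x, x \notin A -> f x = 1]
          (f \in homs A C).
Proof.
rewrite inE; apply: (iffP and3P) => -[fC fM f1]; split.
- by move=> x Ax; apply: (forall_inP fC).
- by move=> x y Ax Ay; apply/eqP; have /forall_inP := forall_inP fM x Ax; apply.
- by move=> x Ax; apply/eqP; apply: (forall_inP f1).
- by apply/forall_inP.
- by apply/forall_inP => x Ax; apply/forall_inP => y Ay; rewrite fM.
- by apply/forall_inP => x Ax; rewrite f1.
Qed.

Section HomsGroup.
Variables (A : {group gT}) (C : {group rT}) (f : {ffun gT -> rT}).
Hypothesis fh : f \in homs A C.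

Lemma homs_mem x : f x \in C.
Proof.
by case/homsP: fh => fC _ f1; case: (boolP (x \in A)) => [/fC|/f1->].
Qed.

Lemma homsM : {in A &, {morph f : x y / x * y}}.
Proof. by case/homsP: fh. Qed.

Lemma homs_out x : x \notin A -> f x = 1.
Proof. by case/homsP: fh => _ _; apply. Qed.

Definition homs_morphism : {morphism A >-> rT} := Morphism homsM.

Lemma homs1 : f 1 = 1. Proof. exact: (morph1 homs_morphism). Qed.

Lemma homsV : {in A, {morph f : x / x^-1}}.
Proof. exact: (morphV homs_morphism). Qed.

Lemma homsX n : {in A, {morph f : x / x ^+ n}}.
Proof. exact: (morphX homs_morphism). Qed.
End HomsGroup.

Definition restrict (A : {set gT}) (f : gT -> rT) : {ffun gT -> rT} :=
  [ffun x => if x \in A then f x else 1].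

Lemma homs_of_morphism (A : {group gT}) (C : {set rT}) (f : {morphism A >-> rT}) :
  {in A, forall x, f x \in C} ->
  restrict A f \in homs A C.
Proof.
move=> fC; apply/homsP; split=> [x Ax|x y Ax Ay|x Ax]; rewrite !ffunE.
- by rewrite Ax fC.
- by rewrite groupM // Ax Ay morphM.
- by rewrite (negPf Ax).
Qed.

Lemma homs_eq (A : {group gT}) (C D : {group rT}) (f g : {ffun gT -> rT}) :
  f \in homs A C -> g \in homs A D -> {in A, f =1 g} -> f = g.
Proof.
move=> fh gh fg; apply/ffunP=> x; case: (boolP (x \in A)) => [/fg //|Ax].
by rewrite (homs_out fh Ax) (homs_out gh Ax).
Qed.

Lemma homsS (A : {set gT}) (C D : {set rT}) : C \subset D -> homs A C \subset homs A D.
Proof.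
move=> sCD; apply/subsetP => f /homsP[fC fM f1]; apply/homsP; split=> // x Ax.
exact/(subsetP sCD)/fC.
Qed.

Lemma homs1_in (A : {group gT}) (C : {group rT}) : (1 : {ffun gT -> rT}) \in homs A C.
Proof. by apply/homsP; split=> [x|x y|x] *; rewrite !ffunE ?mulg1. Qed.

Lemma group_set_homs (A : {group gT}) (C : {group rT}) :
  abelian C -> group_set (homs A C).
Proof.
move=> cC; apply/group_setP; split=> [|f g fh gh]; first exact: homs1_in.
apply/homsP; split=> [x Ax|x y Ax Ay|x Ax]; rewrite !ffunE.
- by rewrite groupM ?(homs_mem fh) ?(homs_mem gh).
- rewrite (homsM fh) // (homsM gh) // !mulgA; congr (_ * _).
  rewrite -!mulgA; congr (_ * _).
  by apply: (centsP cC); rewrite ?(homs_mem fh) ?(homs_mem gh).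
- by rewrite (homs_out fh) // (homs_out gh) // mulg1.
Qed.

Lemma homs_mul (A : {group gT}) (C : {group rT}) (f g : {ffun gT -> rT}) :
  abelian C -> f \in homs A C -> g \in homs A C -> f * g \in homs A C.
Proof. by move=> cC; have /group_setP[_ H] := group_set_homs A cC; apply: H. Qed.

Lemma homs_coprime (A : {group gT}) (C : {group rT}) :
  coprime #|A| #|C| -> #|homs A C| = 1%N.
Proof.
move=> co; apply/eqP/cards1P; exists 1; apply/setP=> f; rewrite inE.
apply/idP/eqP=> [fh|->]; last exact: homs1_in.
apply/ffunP=> x; rewrite ffunE; case: (boolP (x \in A)) => Ax; last exact: homs_out fh x Ax.
apply/eqP; rewrite -order_eq1 -dvdn1 -(eqP co) dvdn_gcd order_dvdG ?(homs_mem fh) // andbT.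
by rewrite order_dvdn -(homsX fh) // expg_cardG ?homs1 // (homs1 fh).
Qed.

End Homs.

(** * Counting homomorphisms out of a product of cyclic groups *)

Section HomsDprod.
Local Open Scope group_scope.
Variables gT rT : finGroupType.
Implicit Types (A B D : {group gT}) (C : {group rT}) (x : gT) (c : rT).

Lemma homs_dprod_extend A B D C (f g : {ffun gT -> rT}) :
  A \x B = D -> abelian C -> f \in homs A C -> g \in homs B C ->
  exists2 h, h \in homs D C & {in A, h =1 f} /\ {in B, h =1 g}.
Proof.
move=> defD cC fh gh.
have cfg : homs_morphism gh @* B \subset 'C(homs_morphism fh @* A).
  apply/centsP => _ /morphimP[x _ Bx ->] _ /morphimP[y _ Ay ->].
  by apply: (centsP cC); rewrite ?(homs_mem fh) ?(homs_mem gh).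
have [_ defD' _ tiAB] := dprodP defD.
have hC : {in D, forall x, dprodm defD cfg x \in C}.
  move=> x; rewrite -defD' => /mulsgP[a b Aa Bb ->].
  by rewrite dprodmE //= groupM ?(homs_mem fh) ?(homs_mem gh).
exists (restrict D (dprodm_morphism defD cfg)).
  exact: (@homs_of_morphism _ _ D C (dprodm_morphism defD cfg) hC).
have sAD : A \subset D by rewrite -defD' mulG_subl.
have sBD : B \subset D by rewrite -defD' mulG_subr.
split=> x ABx; rewrite ffunE.
  by rewrite (subsetP sAD) //= dprodmEl.
by rewrite (subsetP sBD) //= dprodmEr.
Qed.

Lemma homs_restrict A D C f :
  A \subset D -> f \in homs D C -> restrict A f \in homs A C.
Proof.
move=> sAD fh; apply: (homs_of_morphism (f := restrm_morphism sAD (homs_morphism fh))) => x Ax.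
exact: (homs_mem fh).
Qed.

Lemma card_homs_dprod A B D C :
  A \x B = D -> abelian C -> #|homs D C| = (#|homs A C| * #|homs B C|)%N.
Proof.
move=> defD cC; have [_ defD' _ _] := dprodP defD.
have sAD : A \subset D by rewrite -defD' mulG_subl.
have sBD : B \subset D by rewrite -defD' mulG_subr.
pose r (f : {ffun gT -> rT}) := (restrict A f, restrict B f).
rewrite -cardsX -(@card_in_imset _ _ r) => [|f g fh gh [/ffunP eA /ffunP eB]].
  congr #|pred_of_set _|; apply/setP=> -[f g]; rewrite inE; apply/imsetP/andP => /=.
    by case=> h hh [-> ->]; split; apply: homs_restrict hh.
  case=> fh gh; have [h hh [hA hB]] := homs_dprod_extend defD cC fh gh.
  exists h => //; congr (_, _).
    by apply: (homs_eq fh (homs_restrict sAD hh)) => x Ax; rewrite ffunE Ax hA.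
  by apply: (homs_eq gh (homs_restrict sBD hh)) => x Ax; rewrite ffunE Ax hB.
apply: (homs_eq fh gh) => x; rewrite -defD' => /mulsgP[a b Aa Bb ->].
have Da := subsetP sAD a Aa; have Db := subsetP sBD b Bb.
rewrite (homsM fh) // (homsM gh) //; congr (_ * _).
  by have := eA a; rewrite !ffunE Aa.
by have := eB b; rewrite !ffunE Bb.
Qed.

Lemma homs_cycle_extend x C c :
  c \in C -> c ^+ #[x] = 1 -> exists2 h, h \in homs <[x]> C & h x = c.
Proof.
move=> Cc cx; have dv : #[c] %| #[x] by rewrite order_dvdn cx.
have hh : {in <[x]>, forall y, eltm dv y \in C}.
  by move=> _ /cycleP[i ->]; rewrite eltmE groupX.
exists (restrict <[x]> (eltm_morphism dv)).
  exact: (@homs_of_morphism _ _ <[x]>%G C (eltm_morphism dv) hh).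
by rewrite ffunE cycle_id /= eltm_id.
Qed.

Lemma card_homs_cycle x C :
  #|homs <[x]> C| = #|[set c in C | c ^+ #[x] == 1]|.
Proof.
rewrite -(@card_in_imset _ _ (fun f : {ffun gT -> rT} => f x)).
  congr #|pred_of_set _|; apply/setP=> c; rewrite inE; apply/imsetP/andP.
    case=> f fh ->; rewrite (homs_mem (A := <[x]>%G) fh); split=> //.
    by rewrite -(homsX (A := <[x]>%G) fh) ?cycle_id // expg_order (homs1 (A := <[x]>%G) fh).
  by case=> Cc /eqP cx; have [h hh <-] := homs_cycle_extend Cc cx; exists h.
move=> f g fh gh efg; apply: (homs_eq (A := <[x]>%G) fh gh) => _ /cycleP[i ->].
by rewrite (homsX (A := <[x]>%G) fh) ?cycle_id // (homsX (A := <[x]>%G) gh) ?cycle_id // efg.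
Qed.

Lemma dprod_cycles_cons x (b : seq gT) D :
  \big[dprod/1]_(y <- x :: b) <[y]> = D ->
  exists2 E : {group gT}, \big[dprod/1]_(y <- b) <[y]> = E & <[x]> \x E = D.
Proof.
rewrite big_cons => defD; have [[_ E _ defE] _ _ _] := dprodP defD.
by exists E => //; rewrite -defE.
Qed.

(** A cyclic decomposition is a basis: homomorphisms to an abelian group are
    prescribed freely on it, subject only to the orders. *)
Lemma homs_basis_extend (b : seq gT) D C (c : gT -> rT) :
  \big[dprod/1]_(x <- b) <[x]> = D -> abelian C ->
  {in b, forall x, c x \in C /\ c x ^+ #[x] = 1} ->
  exists2 h, h \in homs D C & {in b, h =1 c}.
Proof.
elim: b D => [|x b IH] D defD cC cb.
  by exists 1 => //; apply: homs1_in.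
have [E defE {}defD] := dprod_cycles_cons defD.
have [|g gh gb] := IH E defE cC; first by move=> y yb; apply: cb; rewrite inE yb orbT.
have [Cx cx] := cb x (mem_head _ _).
have [f fh fx] := homs_cycle_extend Cx cx.
have [h hh [hx hE]] := @homs_dprod_extend <[x]>%G E D C f g defD cC fh gh.
exists h => // y; rewrite inE => /predU1P[->|yb]; first by rewrite hx ?cycle_id.
rewrite hE ?gb //; have sE := bigdprodWY defE.
by rewrite -sE mem_gen // (big_rem y yb) /= inE cycle_id.
Qed.

Lemma card_homs_basis (b : seq gT) D C :
  \big[dprod/1]_(x <- b) <[x]> = D -> abelian C ->
  #|homs D C| = (\prod_(x <- b) #|[set c in C | c ^+ #[x] == 1%g]|)%N.
Proof.
elim: b D => [|x b IH] D defD cC.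
  rewrite big_nil; move: defD; rewrite big_nil => <-.
  by apply: homs_coprime; rewrite cards1 coprime1n.
have [E defE {}defD] := dprod_cycles_cons defD.
by rewrite big_cons (card_homs_dprod (A := <[x]>%G) defD cC) card_homs_cycle (IH E).
Qed.

End HomsDprod.

(** * Epimorphisms onto a direct product *)

Section EpisDprod.
Local Open Scope group_scope.
Variables gT rT : finGroupType.
Implicit Types (A : {group gT}) (C K : {group rT}).

Definition comp_hom (sT : finGroupType) (u : {ffun rT -> sT}) (f : {ffun gT -> rT}) :
  {ffun gT -> sT} := [ffun x => u (f x)].

Lemma homs_comp (sT : finGroupType) A K (C : {group sT}) u f :
  f \in homs A K -> u \in homs K C -> comp_hom u f \in homs A C.
Proof.
move=> fh uh; apply/homsP; split=> [x Ax|x y Ax Ay|x Ax]; rewrite !ffunE.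
- exact: homs_mem uh _.
- by rewrite (homsM fh) // (homsM uh) ?(homs_mem fh).
- by rewrite (homs_out fh) // (homs1 uh).
Qed.

Lemma dprod_inj (K1 K2 K : {group rT}) a b c d :
  K1 \x K2 = K -> a \in K1 -> c \in K1 -> b \in K2 -> d \in K2 ->
  a * b = c * d -> a = c /\ b = d.
Proof.
move=> defK Ka Kc Kb Kd e; have [_ defK' _ _] := dprodP defK.
have Kab : a * b \in K by rewrite -defK' mem_mulg.
have [y [z [_ _ _ H]]] := mem_dprod defK Kab.
by have [-> ->] := H a b Ka Kb erefl; have [-> ->] := H c d Kc Kd e.
Qed.

Lemma homs_proj (K1 K2 K : {group rT}) :
  K1 \x K2 = K -> abelian K ->
  exists u v, [/\ u \in homs K K1, v \in homs K K2 &
                 {in K, forall x, u x * v x = x}].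
Proof.
move=> defK cK; have [_ defK' _ _] := dprodP defK.
have sK1 : K1 \subset K by rewrite -defK' mulG_subl.
have sK2 : K2 \subset K by rewrite -defK' mulG_subr.
have idh (L : {group rT}) : restrict L id \in homs L L.
  by apply: (homs_of_morphism (f := idm_morphism L)).
have [u uh [u1 u2]] := homs_dprod_extend defK (abelianS sK1 cK) (idh K1) (homs1_in _ _).
have [v vh [v1 v2]] := homs_dprod_extend defK (abelianS sK2 cK) (homs1_in _ _) (idh K2).
exists u, v; split=> // x; rewrite -defK' => /mulsgP[a b Ka Kb ->].
have Ka' := subsetP sK1 a Ka; have Kb' := subsetP sK2 b Kb.
by rewrite (homsM uh) // (homsM vh) // u1 // u2 // v1 // v2 // !ffunE Ka Kb mulg1 mul1g.
Qed.

(** The first component of an epimorphism onto [K1 \x K2] is onto [K1]; the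
    count is organized by this component. *)
Lemma card_epis_fibers A (K1 K2 K : {group rT}) :
  K1 \x K2 = K -> abelian K ->
  #|epis A K| =
    (\sum_(f in epis A K1) #|[set g in homs A K2 | (f * g)%g \in epis A K]|)%N.
Proof.
move=> defK cK; have [_ defK' _ _] := dprodP defK.
have sK1 : K1 \subset K by rewrite -defK' mulG_subl.
have sK2 : K2 \subset K by rewrite -defK' mulG_subr.
pose S := [set fg : {ffun gT -> rT} * {ffun gT -> rT} |
             [&& fg.1 \in epis A K1, fg.2 \in homs A K2 & fg.1 * fg.2 \in epis A K]].
under eq_bigr => f _ do rewrite -sum1_card.
rewrite pair_big_dep /=.
transitivity #|S|; last first.
  by rewrite -sum1_card; apply: eq_bigl => -[f g]; rewrite !inE.
rewrite -(@card_in_imset _ _ (fun fg => fg.1 * fg.2) (mem S)).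
  congr #|pred_of_set _|; apply/setP=> h; apply/idP/imsetP; last first.
    by case=> -[f g]; rewrite inE => /and3P[_ _ H] ->.
  move=> hK; have := hK; rewrite inE => /andP[hh hs].
  have [u [v [uh vh uv]]] := homs_proj defK cK.
  have hE : h = comp_hom u h * comp_hom v h.
    by apply/ffunP=> x; rewrite !ffunE uv // (homs_mem hh).
  exists (comp_hom u h, comp_hom v h) => //=.
  rewrite inE /= -hE hK (homs_comp hh vh) inE (homs_comp hh uh) /= andbT.
  apply/subsetP=> y Ky; have /imsetP[x Ax ey] := subsetP hs y (subsetP sK1 y Ky).
  apply/imsetP; exists x => //; rewrite ffunE -ey.
  have e : u y * v y = y * 1 by rewrite uv ?mulg1 // (subsetP sK1).
  by have [->] := dprod_inj defK (homs_mem uh y) Ky (homs_mem vh y) (group1 _) e.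
move=> [f g] [f' g']; rewrite inE => /and3P[/= /setIdP[fh _] gh _].
rewrite inE => /and3P[/= /setIdP[fh' _] gh' _] /ffunP e.
have e' x : f x = f' x /\ g x = g' x.
  have ex : f x * g x = f' x * g' x by have := e x; rewrite !ffunE.
  exact: dprod_inj defK (homs_mem fh x) (homs_mem fh' x) (homs_mem gh x) (homs_mem gh' x) ex.
by congr (_, _); apply/ffunP=> x; case: (e' x).
Qed.

(** Raising an element of [A] to a power that is 1 modulo [#|K1|] and 0 modulo
    [#|K2|] keeps its image in [K1] and kills its image in [K2]. *)
Lemma image_coprime_factor A (K1 K2 : {group rT}) f g :
  coprime #|K1| #|K2| -> f \in epis A K1 -> g \in homs A K2 ->
  {in K1, forall y, exists2 x, x \in A & f x = y /\ g x = 1}.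
Proof.
move=> co; rewrite inE => /andP[fh fs] gh y Ky.
have /imsetP[x Ax ->] := subsetP fs y Ky.
exists (x ^+ chinese #|K1| #|K2| 1 0); first exact: groupX.
rewrite (homsX fh) // (homsX gh) //; split.
  rewrite -(expg_mod _ (expg_cardG (homs_mem fh x))) chinese_modl //.
  by rewrite expg_mod ?expg1 // expg_cardG // (homs_mem fh).
rewrite -(expg_mod _ (expg_cardG (homs_mem gh x))) chinese_modr // mod0n //.
Qed.

Lemma card_epis_coprime A (K1 K2 K : {group rT}) :
  K1 \x K2 = K -> abelian K -> coprime #|K1| #|K2| ->
  #|epis A K| = (#|epis A K1| * #|epis A K2|)%N.
Proof.
move=> defK cK co; have [_ defK' _ _] := dprodP defK.
have sK1 : K1 \subset K by rewrite -defK' mulG_subl.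
have sK2 : K2 \subset K by rewrite -defK' mulG_subr.
rewrite (card_epis_fibers A defK cK) -sum_nat_const; apply: eq_bigr => f fe.
congr #|pred_of_set _|; apply/setP=> g; rewrite inE [in RHS]inE.
case: (boolP (g \in homs A K2)) => //= gh.
have := fe; rewrite inE => /andP[fh _].
have fgh : f * g \in homs A K.
  by apply: homs_mul => //; [apply: (subsetP (homsS _ sK1)) | apply: (subsetP (homsS _ sK2))].
rewrite inE fgh /=.
apply/idP/idP=> s; apply/subsetP=> y Ky.
  have /imsetP[x Ax ey] := subsetP s y (subsetP sK2 y Ky).
  have e : 1 * y = f x * g x by rewrite mul1g ey ffunE.
  have [_ ->] := dprod_inj defK (group1 _) (homs_mem fh x) Ky (homs_mem gh x) e.
  exact: imset_f.
have ge : g \in epis A K2 by rewrite inE gh.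
move: Ky; rewrite -defK' => /mulsgP[a b Ka Kb ->].
have [x Ax [<- gx]] := image_coprime_factor co fe gh Ka.
have [z Az [<- fz]] : exists2 x, x \in A & g x = b /\ f x = 1.
  by apply: (image_coprime_factor _ ge fh Kb); rewrite coprime_sym.
apply/imsetP; exists (x * z); first exact: groupM.
by rewrite ffunE (homsM fh) // (homsM gh) // gx fz mulg1 mul1g.
Qed.

End EpisDprod.

(** * Adding a smallest cyclic factor to the target *)

Section EpisCycle.
Local Open Scope group_scope.
Variables gT rT : finGroupType.
Variables (A : {group gT}) (K' K : {group rT}) (x : rT) (b : seq rT) (p : nat).
Hypothesis defK : K' \x <[x]> = K.
Hypothesis defK' : \big[dprod/1]_(y <- b) <[y]> = K'.
Hypothesis cK : abelian K.
Hypothesis p_pr : prime p.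
Hypothesis px : p.-elt x.
Hypothesis x1 : x != 1.
Hypothesis dvdb : {in b, forall y, #[x] %| #[y]}.

(** An exponent that [p] does not divide is prime to [#[x]], so every proper
    subgroup of the cyclic [p]-group [<[x]>] lies in [<[x ^+ p]>]. *)
Lemma cycle_gen_of_notin z : z \in <[x]> -> z \notin <[x ^+ p]> -> x \in <[z]>.
Proof.
case/cycleP=> i ->; case: (boolP (p %| i)) => [/dvdnP[k ->]|pi _].
  by rewrite mulnC expgM mem_cycle.
have : generator <[x]> (x ^+ i).
  rewrite generator_coprime; apply: (pnat_coprime px).
  by rewrite p'natE.
by rewrite /generator => /eqP <-; apply: cycle_id.
Qed.

Lemma order_cycle_exp : #[x] = (p * #[x ^+ p]%g)%N.
Proof.
have [[|k] ox] := p_natP px; first by move/eqP: ox; rewrite order_eq1 (negPf x1).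
by rewrite orderXdiv ox expnS ?dvdn_mulr // mulKn ?prime_gt0.
Qed.

Lemma notin_cycle_exp : x \notin <[x ^+ p]>.
Proof.
apply/negP; rewrite -cycle_subG => /subset_leq_card; rewrite -!orderE order_cycle_exp.
by rewrite leqNgt ltn_Pmull ?prime_gt1 ?order_gt0.
Qed.

Definition lifts (f : {ffun gT -> rT}) : {set {ffun gT -> rT}} :=
  [set comp_hom psi f | psi in homs K' (<[x]>%G)].

(** If [g] is [psi o f] modulo [<x^p>], then [g] maps the kernel of [f] into
    [<x^p>], and [x] is not reached.  Conversely, if [f * g] is not onto, then
    [g] maps the kernel of [f] into a proper subgroup of [<x>], hence into
    [<x^p>].  Sending each basis element [z] of [K'] to the value of [g] at a
    preimage of [z] defines [psi]: the relation [z ^+ #[z] = 1] is respected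
    because [#[x]] divides [#[z]]. *)
Lemma epis_mul_cycle f g :
  f \in epis A K' -> g \in homs A <[x]> ->
  (f * g \in epis A K) = (g \notin lifts f * homs A <[x ^+ p]>).
Proof.
have [_ defKm _ _] := dprodP defK.
have sK' : K' \subset K by rewrite -defKm mulG_subl.
have sX : <[x]> \subset K by rewrite -defKm mulG_subr.
have cX : abelian <[x]> := abelianS sX cK.
case/setIdP=> fh fs gh.
have fgh : f * g \in homs A K.
  by apply: homs_mul => //; [apply: (subsetP (homsS _ sK')) | apply: (subsetP (homsS _ sX))].
have gX := homs_mem (C := <[x]>%G) gh.
apply/idP/idP=> [/setIdP[_ s]|].
  apply/negP=> /mulsgP[_ k /imsetP[psi psih ->] kh eg].
  have /imsetP[h Ah] := subsetP s x (subsetP sX x (cycle_id x)); rewrite ffunE => eh.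
  have e : 1 * x = f h * g h by rewrite mul1g.
  have [fh1 gx] := dprod_inj defK (group1 _) (homs_mem fh h) (cycle_id x) (gX h) e.
  have := notin_cycle_exp; rewrite {1}gx eg !ffunE -fh1 (homs1 (C := <[x]>%G) psih) mul1g.
  by rewrite (homs_mem (C := <[_]>%G) kh).
apply: contraR => nepi.
(* Otherwise a power of h lies over 1 and is mapped to x: then <[x]>, and with
   it K, is in the image of f * g. *)
have kerf h : h \in A -> f h = 1 -> g h \in <[x ^+ p]>.
  move=> Ah fh1; apply: contraR nepi => /(cycle_gen_of_notin (gX h)) /cycleP[i ex].
  rewrite inE fgh -defKm; apply/subsetP=> _ /mulsgP[a y Ka Xy ->].
  have /imsetP[h' Ah' ea] := subsetP fs a Ka.
  have /cycleP[j ej] : (g h')^-1 * y \in <[x]> by rewrite groupM ?groupV.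
  have Ahij : (h ^+ i) ^+ j \in A by rewrite !groupX.
  apply/imsetP; exists (h' * (h ^+ i) ^+ j); first by rewrite groupM.
  rewrite ffunE (homsM fh) // (homsM (C := <[x]>%G) gh) // -ea !(homsX fh) ?groupX //.
  by rewrite fh1 !expg1n mulg1 !(homsX (C := <[x]>%G) gh) ?groupX // -ex -ej mulKVg.
pose s z := odflt 1 [pick h in A | f h == z].
have sP z : z \in K' -> s z \in A /\ f (s z) = z.
  rewrite /s => Kz; case: pickP => [h /andP[Ah /eqP] //|none].
  by have /imsetP[h Ah ez] := subsetP fs z Kz; have := none h; rewrite Ah -ez eqxx.
have [psi psih psib] : exists2 psi, psi \in homs K' <[x]> & {in b, psi =1 (fun z => g (s z))}.
  apply: (homs_basis_extend (C := <[x]>%G) defK' cX) => z zb; split; first exact: gX.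
  apply/eqP; rewrite -order_dvdn (dvdn_trans _ (dvdb zb)) //.
  by apply: order_dvdG.
have zh : comp_hom psi f \in homs A <[x]> := homs_comp (C := <[x]>%G) fh psih.
pose k := (comp_hom psi f)^-1 * g.
have kX : k \in homs A <[x]>.
  pose X := Group (group_set_homs A (C := <[x]>%G) cX).
  by rewrite -[homs _ _]/(X : {set _}) groupM ?groupV.
suff kY : k \in homs A <[x ^+ p]>.
  by apply/mulsgP; exists (comp_hom psi f) k; rewrite ?mulKVg //; apply/imsetP; exists psi.
have kE h : h \in A -> k h = (psi (f h))^-1 * g h by rewrite !ffunE.
pose mk := homs_morphism (C := <[x]>%G) kX; pose mf := homs_morphism fh.
(* The preimage of <[x ^+ p]> under k contains the chosen preimages of the basis
   of K', so f maps it onto K'; it also contains the kernel of f, hence it is A. *)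
have onto : K' \subset mf @* (mk @*^-1 <[x ^+ p]>).
  rewrite -(bigdprodWY defK') gen_subG big_seq.
  apply: (big_ind (fun B : {set rT} => B \subset _)) => [|B C sB sC|z zb].
  - exact: sub0set.
  - by rewrite subUset sB.
  have Kz : z \in K' by rewrite -(bigdprodWY defK') mem_gen // (big_rem z zb) inE cycle_id.
  have [As fz] := sP z Kz; rewrite cycle_subG -fz.
  apply: (mem_morphim mf) => //; rewrite !inE As /= kE //.
  by rewrite fz psib // mulVg group1.
apply/homsP; split; last 1 first.
- exact: (homs_out (C := <[x]>%G) kX).
- move=> h Ah; have /morphimP[h' Ah' Bh' eh] := subsetP onto _ (homs_mem fh h).
  have Ad : h'^-1 * h \in A by rewrite groupM ?groupV.
  have f1 : f (h'^-1 * h) = 1.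
    by rewrite (homsM fh) ?groupV // (homsV fh) // eh mulVg.
  have kd : k (h'^-1 * h) \in <[x ^+ p]>.
    by rewrite kE // f1 (homs1 (C := <[x]>%G) psih) invg1 mul1g kerf.
  rewrite -(mulKVg h' h) (homsM (C := <[x]>%G) kX) //.
  by rewrite groupM //; move: Bh'; rewrite !inE => /andP[].
- exact: (homsM (C := <[x]>%G) kX).
Qed.

(** No element of [<x>] is excluded as image of a basis element of [K'], since
    [#[x]] divides the orders of these elements. *)
Lemma card_homs_basis_full (C : {group rT}) :
  C \subset <[x]> -> #|homs K' C| = (#|C| ^ size b)%N.
Proof.
move=> sC; have [_ defKm _ _] := dprodP defK.
have sX : <[x]> \subset K by rewrite -defKm mulG_subr.
rewrite (card_homs_basis defK' (abelianS (subset_trans sC sX) cK)).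
rewrite (eq_big_seq (fun=> #|C|)) => [|y yb].
  by rewrite big_const_seq count_predT iter_muln_1.
congr #|pred_of_set _|; apply/setP=> c; rewrite inE andbC.
case: (boolP (c \in C)) => Cc; last by rewrite andbF.
by rewrite andbT -order_dvdn (dvdn_trans _ (dvdb yb)) // order_dvdG // (subsetP sC).
Qed.

(** The two subgroups meet in the maps [psi o f] with [psi] valued in [<x^p>];
    [mul_cardG] then gives [#|<x>|^s * #|homs A <x^p>| / #|<x^p>|^s]. *)
Lemma card_lifts_mul f : f \in epis A K' ->
  #|lifts f * homs A <[x ^+ p]>| = (p ^ size b * #|homs A <[(x ^+ p)%g]>|)%N.
Proof.
case/setIdP=> fh fs; have [_ defKm _ _] := dprodP defK.
have sX : <[x]> \subset K by rewrite -defKm mulG_subr.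
have cX : abelian <[x]> := abelianS sX cK.
have sYX : <[x ^+ p]> \subset <[x]> by rewrite cycle_subG mem_cycle.
have cY : abelian <[x ^+ p]> := abelianS sYX cX.
have inj : {in homs K' <[x]> &, injective (fun psi : {ffun rT -> rT} => comp_hom psi f)}.
  move=> u v uh vh /ffunP e; apply: (homs_eq (C := <[x]>%G) (D := <[x]>%G) uh vh) => y Ky.
  by have /imsetP[h Ah ->] := subsetP fs y Ky; have := e h; rewrite !ffunE.
have Zg : group_set (lifts f).
  apply/group_setP; split=> [|_ _ /imsetP[u uh ->] /imsetP[v vh ->]].
    by apply/imsetP; exists 1; [apply: (homs1_in _ <[x]>%G) | apply/ffunP=> y; rewrite !ffunE].
  apply/imsetP; exists (u * v); first exact: (homs_mul (C := <[x]>%G)).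
  by apply/ffunP=> y; rewrite !ffunE.
have := mul_cardG (Group Zg) (Group (group_set_homs A (C := <[x ^+ p]>%G) cY)) => /=.
have -> : lifts f :&: homs A <[x ^+ p]> =
          [set comp_hom psi f | psi in homs K' (<[x ^+ p]>%G)].
  apply/setP=> h; apply/setIP/imsetP=> [[/imsetP[u uh ->] ch]|[u uh ->]]; last first.
    split; last exact: (homs_comp (C := <[x ^+ p]>%G) fh uh).
    by apply: imset_f; apply: subsetP uh; apply: homsS.
  exists u => //; apply/homsP; split=> [y Ky|y z Ky Kz|y].
  - have /imsetP[k Ak ->] := subsetP fs y Ky.
    by have := homs_mem (C := <[x ^+ p]>%G) ch k; rewrite ffunE.
  - exact: (homsM (C := <[x]>%G) uh).
  - exact: (homs_out (C := <[x]>%G) uh).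
rewrite !card_in_imset ?card_homs_basis_full //; last first.
  by apply: sub_in2 inj => u; apply: subsetP; apply: homsS.
rewrite -!orderE order_cycle_exp expnMn => e.
apply/eqP; rewrite -(eqn_pmul2r (m := #[x ^+ p] ^ size b)%N) ?expn_gt0 ?order_gt0 //.
by rewrite -e mulnAC.
Qed.

Lemma card_epis_cycle :
  (#|epis A K|%:R =
   #|epis A K'|%:R * (#|homs A <[x]>%g|%:R -
                      p%:R ^+ size b * #|homs A <[(x ^+ p)%g]>%g|%:R) :> rat)%R.
Proof.
have [_ defKm _ _] := dprodP defK.
have sX : <[x]> \subset K by rewrite -defKm mulG_subr.
have cX : abelian <[x]> := abelianS sX cK.
have sYX : <[x ^+ p]> \subset <[x]> by rewrite cycle_subG mem_cycle.
rewrite (card_epis_fibers A defK cK) natr_sum mulr_natl -sumr_const.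
apply: eq_bigr => f fe.
have sub : lifts f * homs A <[x ^+ p]> \subset homs A <[x]>.
  case/setIdP: fe => fh _; apply/subsetP=> _ /mulsgP[_ k /imsetP[u uh ->] kh ->].
  apply: (homs_mul (C := <[x]>%G)) => //; first exact: (homs_comp (C := <[x]>%G) fh uh).
  exact: subsetP (homsS A sYX) k kh.
rewrite -natrX -natrM -(card_lifts_mul fe) -natrB ?subset_leq_card // -cardsDS //.
congr (#|pred_of_set _|%:R)%R; apply/setP=> g; apply/setIdP/setDP=> -[].
  by move=> gh; rewrite epis_mul_cycle.
by move=> gh gZ; rewrite epis_mul_cycle.
Qed.

End EpisCycle.

(** * Epimorphisms onto an abelian group *)

Section PrimaryCount.
Local Open Scope group_scope.
Variables gT rT : finGroupType.
Implicit Types (A : {group gT}) (K : {group rT}).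

Lemma card_epis_trivial A : #|epis A (1 : {set rT})| = 1%N.
Proof.
rewrite -(homs_coprime (A := A) (C := [1 rT]%G)) ?cards1 ?coprimen1 //.
congr #|pred_of_set _|; apply/setP=> f; rewrite inE andb_idr // => fh.
apply/subsetP=> _ /set1P->; apply/imsetP; exists 1; rewrite ?group1 //.
by rewrite (homs1 (C := [1 rT]%G) fh).
Qed.

(** Induction on the basis, whose last element has the smallest order, as
    [card_epis_cycle] requires of the factor that is added. *)
Lemma card_epis_basis A K (p : nat) (b : seq rT) (h : nat -> nat) :
  prime p -> abelian K -> p.-group K ->
  \big[dprod/1]_(x <- b) <[x]> = K -> {in b, forall x, x != 1} ->
  sorted geq [seq logn p #[x] | x <- b] ->
  (forall z : rT, p.-elt z -> #|homs A <[z]>| = h (logn p #[z])) ->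
  (#|epis A K|%:R =
   \prod_(i < size b)
     ((h (nth 0%N [seq logn p #[x] | x <- b] i))%:R -
      p%:R ^+ i * (h (nth 0%N [seq logn p #[x] | x <- b] i).-1)%:R) :> rat)%R.
Proof.
move=> p_pr; elim/last_ind: b K => [|b x IH] K cK pK defK b1 srt hE.
  rewrite big_ord0; move: defK; rewrite big_nil => <-.
  by rewrite card_epis_trivial.
move: srt defK; rewrite map_rcons sorted_pairwise; last exact: rev_trans leq_trans.
rewrite pairwise_rcons -sorted_pairwise; last exact: rev_trans leq_trans.
case/andP=> xmin srt; rewrite big_rcons /= => defK.
have [[K' _ defK' _] defKm _ _] := dprodP defK.
rewrite defK' in defK defKm.
have sK' : K' \subset K by rewrite -defKm mulG_subl.
have sX : <[x]> \subset K by rewrite -defKm mulG_subr.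
have pb : {in b, forall y, p.-elt y}.
  move=> y yb; apply: (mem_p_elt pK); apply: (subsetP sK').
  by rewrite -(bigdprodWY defK') mem_gen // (big_rem y yb) inE cycle_id.
have px : p.-elt x by apply: (mem_p_elt pK); apply: (subsetP sX); apply: cycle_id.
have x1 : x != 1 by apply: b1; rewrite mem_rcons mem_head.
have dvdb : {in b, forall y, #[x] %| #[y]}.
  move=> y yb; have [i ei] := p_natP (pb y yb); have [j ej] := p_natP px.
  move: xmin; rewrite all_map => /allP/(_ y yb) /=.
  by rewrite ei ej !pfactorK // => le; apply: dvdn_exp2l.
have IHb := IH K' (abelianS sK' cK) (pgroupS sK' pK) defK' _ srt hE.
rewrite (card_epis_cycle A defK defK' cK p_pr px x1 dvdb) size_rcons big_ord_recr /=.
have {}IHb : (#|epis A K'|%:R =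
   \prod_(i < size b)
     ((h (nth 0%N [seq logn p #[x] | x <- b] i))%:R -
      p%:R ^+ i * (h (nth 0%N [seq logn p #[x] | x <- b] i).-1)%:R) :> rat)%R.
  by apply: IHb => y yb; apply: b1; rewrite mem_rcons inE yb orbT.
have -> : nth 0%N (rcons [seq logn p #[x0] | x0 <- b] (logn p #[x])) (size b) = logn p #[x].
  by rewrite nth_rcons size_map ltnn eqxx.
under eq_bigr => i _ do rewrite nth_rcons size_map ltn_ord.
rewrite -{}IHb.
have px' : p.-elt (x ^+ p) by apply: (mem_p_elt px); apply: mem_cycle.
rewrite !hE //; congr (_ * (_ - _ * (h _)%:R))%R.
rewrite (order_cycle_exp p_pr px x1) lognM ?order_gt0 ?prime_gt0 //.
by rewrite (@logn_prime p p p_pr) eqxx.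
Qed.

Lemma card_epis_primary A K :
  abelian K -> #|epis A K| = (\prod_(p <- primes #|K|) #|epis A 'O_p(K)|)%N.
Proof.
move=> cK; pose pi_of (s : seq nat) : nat_pred := [pred q in s].
have H s : uniq s -> #|epis A 'O_(pi_of s)(K)| = (\prod_(p <- s) #|epis A 'O_p(K)|)%N.
  elim: s => [|p s IH] /=.
    rewrite big_nil => _; suff -> : 'O_(pi_of [::])(K) = 1 by apply: card_epis_trivial.
    apply/card1_trivg/(@pnat_1 (pi_of [::])); first exact: pcore_pgroup.
    by apply/pnatP=> // q _ _; rewrite !inE.
  case/andP=> ps us; rewrite big_cons -IH //.
  have sO : 'O_(pi_of (p :: s))(K) \subset K := pcore_sub _ _.
  have cO := abelianS sO cK.
  have defO := nilpotent_pcoreC p (abelian_nil cO).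
  rewrite -!pcoreI in defO.
  have e1 : 'O_[predI ((p : nat) : nat_pred) & pi_of (p :: s)](K) = 'O_p(K).
    by apply: eq_pcore => q; rewrite !inE; case: eqVneq.
  have e2 : 'O_[predI ((p : nat) : nat_pred)^' & pi_of (p :: s)](K) = 'O_(pi_of s)(K).
    apply: eq_pcore => q; rewrite !inE; case: eqVneq => //= ->.
    by rewrite (negPf ps).
  rewrite e1 e2 in defO.
  rewrite (card_epis_coprime (K1 := 'O_p(K)%G) (K2 := 'O_(pi_of s)(K)%G) A defO cO) //.
  apply: (@pnat_coprime p); first exact: pcore_pgroup.
  apply: (sub_in_pnat (pi := pi_of s)); last exact: pcore_pgroup.
  by move=> q _; rewrite !inE => qs; apply: contraNneq ps => <-.
rewrite -H ?primes_uniq // [in LHS](_ : K :=: 'O_(pi_of (primes #|K|))(K)) //.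
apply/esym/pcore_pgroup_id; apply: sub_in_pnat (pnat_pi (cardG_gt0 K)) => q _.
by rewrite !inE.
Qed.

End PrimaryCount.

(** * Homomorphisms to a cyclic p-group *)

Section SourceCount.
Local Open Scope group_scope.
Variable gT rT : finGroupType.

Lemma card_cycle_roots (p m : nat) (z : rT) : prime p -> p.-elt z ->
  #|[set c in <[z]> | c ^+ (p ^ m)%N == 1]| = (p ^ minn (logn p #[z]) m)%N.
Proof.
move=> p_pr pz; have cO : abelian 'Ohm_m(<[z]>) := abelianS (Ohm_sub _ _) (cycle_abelian z).
transitivity #|'Ohm_m(<[z]>)|.
  rewrite (OhmEabelian pz cO); congr #|pred_of_set _|.
  by apply/setP=> c; rewrite !inE.
rewrite (Ohm_p_cycle _ pz) -orderE orderXdiv.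
  rewrite -{1}(part_pnat_id pz) p_part -expnB ?prime_gt0 ?leq_subr //.
  by congr (p ^ _)%N; rewrite minnE.
by rewrite -{2}(part_pnat_id pz) p_part dvdn_exp2l // leq_subr.
Qed.

Lemma torsion_part_pcore (p : nat) : abelian [set: gT] ->
  torsion_part p gT = 'O_p([set: gT]).
Proof.
move=> cG; apply/setP=> x; rewrite inE.
by rewrite (mem_normal_Hall (nilpotent_pcore_Hall p (abelian_nil cG)) (pcore_normal _ _)) ?inE.
Qed.

Lemma card_homs_to_pcycle (p : nat) (z : rT) :
  abelian [set: gT] -> prime p -> p.-elt z ->
  #|homs [set: gT] <[z]>| =
    (p ^ \sum_(u <- ptype p (torsion_part p gT)) minn (logn p #[z]) u)%N.
Proof.
move=> cG p_pr pz; rewrite torsion_part_pcore //.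
have cO := abelianS (pcore_sub p [set: gT]) cG.
have defG := nilpotent_pcoreC p (abelian_nil cG).
rewrite (card_homs_dprod (C := <[z]>%G) defG (cycle_abelian z)).
rewrite [X in (_ * X)%N]homs_coprime ?muln1; last first.
  by rewrite coprime_sym; apply: pnat_coprime pz (pcore_pgroup _ _).
have [_ _ [b defO ob]] := ptypeP p_pr cO (pcore_pgroup p _).
rewrite (card_homs_basis (C := <[z]>%G) defO (cycle_abelian z)).
rewrite expn_sum.
rewrite -(big_map (fun x : gT => #[x]) xpredT (fun m => #|[set c in <[z]> | c ^+ m == 1]|)).
rewrite ob big_map; apply: eq_bigr => u _; exact: card_cycle_roots.
Qed.

End SourceCount.

(** * The arithmetic of the two counts *)

Section Arithmetic.
Local Open Scope ring_scope.

(** The number of homomorphisms from [Z^n + T] to the cyclic group of order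
    [p ^ k], when [tau] is the type of the [p]-part of [T]. *)
Definition hom_count (p n : nat) (tau : seq nat) (k : nat) : nat :=
  (p ^ (k * n + \sum_(u <- tau) minn k u))%N.

(** The number of epimorphisms onto an abelian [p]-group of type [lam], when
    [h k] homomorphisms go to the cyclic group of order [p ^ k]. *)
Definition epi_count (p : nat) (h : nat -> nat) (lam : seq nat) : rat :=
  \prod_(i < size lam)
    ((h (nth 0%N lam i))%:R - p%:R ^+ i * (h (nth 0%N lam i).-1)%:R).

Lemma sumn_nth (s : seq nat) : (sumn s = \sum_(i < size s) nth 0 s i)%N.
Proof. by rewrite sumnE (big_nth 0%N) big_mkord. Qed.

Lemma epi_count_numerator (p n : nat) (lam tau : seq nat) :
  all (leq 1) lam ->
  epi_count p (hom_count p n tau) lam =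
    p%:R ^+ ((part_weight lam - part_length lam) * n + theta (part_lower lam) tau)%N *
    \prod_(i < part_length lam)
      (p%:R ^+ (n + theta_row lam tau i - theta_row (part_lower lam) tau i)%N - p%:R ^+ i).
Proof.
move=> lam1; rewrite /part_length /epi_count.
have pos (i : 'I_(size lam)) : (0 < nth 0 lam i)%N by apply: (allP lam1); apply: mem_nth.
have lowE (i : 'I_(size lam)) :
    theta_row (part_lower lam) tau i = (\sum_(u <- tau) minn (nth 0 lam i).-1 u)%N.
  by rewrite /theta_row (nth_map 0%N).
have -> : ((part_weight lam - size lam) * n + theta (part_lower lam) tau =
  \sum_(i < size lam) ((nth 0 lam i).-1 * n + theta_row (part_lower lam) tau i))%N.
  rewrite big_split /= -big_distrl /= /theta size_map; congr (_ * _ + _)%N.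
  rewrite -[X in _ = X](addnK (size lam)); congr (_ - _)%N.
  transitivity (\sum_(i < size lam) ((nth 0 lam i).-1 + 1))%N.
    by rewrite /part_weight sumn_nth; apply: eq_bigr => i _; rewrite addn1 prednK.
  by rewrite big_split /= sum1_card card_ord.
rewrite expr_sum -big_split /=; apply: eq_bigr => i _.
rewrite mulrBr -exprD mulrC /hom_count !natrX -lowE; congr (_ ^+ _ - _).
have le : (theta_row (part_lower lam) tau i <= theta_row lam tau i)%N.
  by rewrite lowE; apply: leq_sum => u _; rewrite leq_min geq_minr geq_min leq_pred.
rewrite -/(theta_row lam tau i) -{1}(prednK (pos i)) mulSn; lia.
Qed.

(** Both sides grow by [x + 2 * sumn l] when a part [x] that is at least as large
    as those of [l] is put in front of [l]. *)
Lemma sum_min_weight (lam : seq nat) : sorted geq lam ->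
  (\sum_(x <- lam) \sum_(u <- lam) minn x u = part_weight lam + 2 * part_angle lam)%N.
Proof.
elim: lam => [|x l IH]; first by rewrite big_nil /part_angle big_ord0.
move=> /[dup] /path_sorted /IH {}IH; rewrite /= path_sortedE; last exact: rev_trans leq_trans.
case/andP=> /allP xl _; rewrite big_cons big_cons minnn.
have e1 : (\sum_(u <- l) minn x u = sumn l)%N.
  by rewrite sumnE; apply: eq_big_seq => u /xl /= ux; apply/minn_idPr.
have -> : (\sum_(y <- l) \sum_(u <- x :: l) minn y u =
           sumn l + \sum_(y <- l) \sum_(u <- l) minn y u)%N.
  under eq_bigr => y _ do rewrite big_cons minnC.
  by rewrite big_split /= e1.
have -> : part_angle (x :: l) = (sumn l + part_angle l)%N.
  rewrite /part_angle /= big_ord_recl mul0n add0n sumn_nth -big_split /=.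
  by apply: eq_bigr => i _; rewrite /= mulSn.
rewrite e1 IH /part_weight /=; lia.
Qed.

(** Removing the largest part [x] lowers by one both the index [i] of every other
    part and the number of parts that are at least as large, so their
    factors do not change.  The factor of [x] itself is [1 - q ^+ m] with [m] the
    multiplicity of [x]: it is the last factor of [varphi m q]. *)
Lemma prod_varphi (q : rat) (N : nat) (lam : seq nat) :
  sorted geq lam -> all (fun k => 0 < k <= N)%N lam ->
  \prod_(i < size lam) (1 - q ^+ (count (leq (nth 0 lam i)) lam - i)%N) =
  \prod_(1 <= k < N.+1) varphi (part_mult k lam) q.
Proof.
elim: lam => [|x l IH].
  by rewrite big_ord0 big1 // => k _; rewrite /varphi big_nil.
move=> /[dup] /path_sorted /IH {}IH; rewrite /= path_sortedE; last exact: rev_trans leq_trans.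
case/andP=> /allP xl _ /andP[xN lN]; rewrite big_ord_recl subn0 /= leqnn.
under eq_bigr => i _.
  have -> : (nth 0 l i <= x)%N by apply/xl/mem_nth.
  rewrite /bump /= subSS; over.
rewrite IH // {IH}.
have xin : x \in index_iota 1 N.+1 by rewrite mem_index_iota ltnS.
rewrite !(bigD1_seq x) ?iota_uniq //= mulrA; congr (_ * _); last first.
  by apply: eq_bigr => k /negPf kx; rewrite /part_mult /= eq_sym kx.
rewrite /part_mult /= eqxx /varphi mulrC [in RHS]big_nat_recr //=; congr (_ * (1 - _ ^+ _)).
congr (_ + _)%N; apply: eq_in_count => y /xl /= yx.
by rewrite eqn_leq yx andTb.
Qed.

(** With [c] the number of parts that are at least [lam_i], passing from [lam_i]
    to [lam_i - 1] divides [hom_count] by [p ^ c], and [i < c] because [lam] is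
    sorted; so the [i]-th factor is [hom_count] at [lam_i] times
    [1 - p ^ - (c - i)]. *)
Lemma epi_count_denominator (p : nat) (lam : seq nat) :
  (0 < p)%N -> sorted geq lam -> all (leq 1) lam ->
  epi_count p (hom_count p 0 lam) lam =
    p%:R ^+ (part_weight lam + 2 * part_angle lam)%N *
    \prod_(1 <= k < (part_weight lam).+1) varphi (part_mult k lam) (p%:R^-1).
Proof.
move=> p0 srt lam1; have pn0 : p%:R != 0 :> rat by rewrite pnatr_eq0 -lt0n.
rewrite -prod_varphi //; last first.
  apply/allP=> k kl; rewrite (allP lam1) //=.
  by rewrite /part_weight sumnE (big_rem k kl) leq_addr.
rewrite -sum_min_weight // (big_nth 0%N) big_mkord expr_sum -big_split /=.
apply: eq_bigr => i _; set k := nth 0%N lam i.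
have k0 : (0 < k)%N by apply: (allP lam1); apply: mem_nth.
have ci : (i < count (leq k) lam)%N.
  have := count_cat (leq k) (take i.+1 lam) (drop i.+1 lam); rewrite cat_take_drop => ->.
  rewrite (_ : count (leq k) (take i.+1 lam) = i.+1) ?leq_addr //.
  have/eqP-> : count (leq k) (take i.+1 lam) == size (take i.+1 lam).
    rewrite -all_count; apply/(all_nthP 0%N) => j; rewrite size_takel // => ji.
    rewrite nth_take //; apply: (sorted_leq_nth _ _ _ srt); rewrite ?inE //.
    - exact: rev_trans leq_trans.
    - exact: leqnn.
    - exact: leq_trans ji (ltn_ord i).
  by rewrite size_takel.
have step : (\sum_(u <- lam) minn k u = count (leq k) lam + \sum_(u <- lam) minn k.-1 u)%N.
  rewrite -sum1_count [X in (X + _)%N]big_mkcond -big_split /=; apply: eq_bigr => u _.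
  by case: (leqP k u); lia.
rewrite /hom_count !muln0 !add0n !natrX step mulrBr mulr1; congr (_ - _).
rewrite -[X in p%:R ^+ (X + _)%N](subnKC (ltnW ci)) addnAC exprD -mulrA.
by rewrite exprVn mulfV ?expf_neq0 // mulr1 exprD.
Qed.

End Arithmetic.

(** * The finite source T x (Z/e)^n *)

Section FreeSource.
Local Open Scope group_scope.
Variables (T : finZmodType) (n e : nat) (rT : finGroupType) (C : {group rT}).
Hypothesis e1 : (1 < e)%N.
Hypothesis cC : abelian C.
Hypothesis Ce : {in C, forall c, #[c] %| e}.

Local Notation S := (T * 'rV['Z_e]_n)%type.

Definition power_hom (c : 'I_n -> rT) (v : 'rV['Z_e]_n) : rT :=
  \prod_(i < n) c i ^+ v ord0 i.

Lemma prod_mulM (a b : 'I_n -> rT) :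
  (forall i, a i \in C) -> (forall i, b i \in C) ->
  \prod_(i < n) (a i * b i) = \prod_(i < n) a i * \prod_(i < n) b i.
Proof.
move=> Ca Cb.
suff [//] : [/\ \prod_(i < n) (a i * b i) = \prod_(i < n) a i * \prod_(i < n) b i,
   \prod_(i < n) a i \in C & \prod_(i < n) b i \in C].
apply: (big_rec3 (fun u v w => [/\ w = u * v, u \in C & v \in C])) => [|i u v w _ [-> Cu Cv]].
  by rewrite mulg1.
split; rewrite ?groupM //.
by rewrite !mulgA -(mulgA (a i)) (centsP cC _ (Cb i) _ Cu) mulgA.
Qed.

Lemma power_homD c : (forall i, c i \in C) ->
  forall v w, power_hom c (v + w)%R = power_hom c v * power_hom c w.
Proof.
move=> Cc v w; rewrite -prod_mulM; try by move=> i; rewrite groupX.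
apply: eq_bigr => i _; rewrite mxE expgD_Zp //; first exact: ltnW.
exact: Ce.
Qed.

Lemma homs_source_sum (f : {ffun S -> rT}) : f \in homs [set: S] C ->
  forall s : S, f s = f (s.1, 0%R) * power_hom (fun i => f (0%R, delta_mx ord0 i)) s.2.
Proof.
move=> fh [t v] /=.
have fM (a b : S) : f (a + b)%R = f a * f b by rewrite -(homsM (A := [set: S]%G) fh) ?inE.
have f0 : f 0%R = 1 := homs1 (A := [set: S]%G) fh.
have -> : (t, v) = ((t, 0) + (0, v))%R :> S by congr (_, _); rewrite /= ?addr0 ?add0r.
rewrite fM; congr (_ * _); rewrite {1}[v]row_sum_delta.
have gD : {morph (fun w => f (0%R, w)) : a b / (a + b)%R >-> a * b}.
  by move=> a b; rewrite -fM; congr (f (_, _)); rewrite addr0.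
rewrite (big_morph _ gD f0).
apply: eq_bigr => i _; rewrite -{1}[v 0%R i]natr_Zp scaler_nat.
elim: (val (v ord0 i)) => [|k IH]; first exact: f0.
by rewrite mulrS expgS -IH -fM; congr (f (_, _)); rewrite addr0.
Qed.

(** The unit vectors are a basis of [(Z/e)^n] over [Z/e], and [e] annihilates
    [C]: their images can be any elements of [C]. *)
Lemma card_homs_source :
  #|homs [set: S] C| = (#|homs [set: T] C| * #|C| ^ n)%N.
Proof.
pose F := [set c : {ffun 'I_n -> rT} | c \in ffun_on (mem C)].
have FP (c : {ffun 'I_n -> rT}) : reflect (forall i, c i \in C) (c \in F).
  by rewrite inE; apply: ffun_onP.
have -> : (#|C| ^ n = #|F|)%N by rewrite cardsE -[n in LHS]card_ord -card_ffun_on; apply: eq_card.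
pose phi (gc : {ffun T -> rT} * {ffun 'I_n -> rT}) : {ffun S -> rT} :=
  [ffun s : S => gc.1 s.1 * power_hom gc.2 s.2].
rewrite -cardsX -(@card_in_imset _ _ phi).
  congr #|pred_of_set _|; apply/setP=> f; apply/idP/imsetP=> [fh|].
    exists ([ffun t => f (t, 0%R)], [ffun i => f (0%R, delta_mx ord0 i)]).
      rewrite in_setX; apply/andP; split => /=.
        apply/homsP; split=> [t _|t u _ _|t]; rewrite ?inE // !ffunE.
          exact: (homs_mem (A := [set: S]%G) fh).
        rewrite -(homsM (A := [set: S]%G) fh) ?inE //.
        by congr (f (_, _)); apply/esym/addr0.
      by apply/FP=> i; rewrite ffunE; apply: (homs_mem (A := [set: S]%G) fh).
    apply/ffunP=> s; rewrite (homs_source_sum fh) !ffunE /=; congr (_ * _).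
    by apply: eq_bigr => i _; rewrite ffunE.
  case=> -[g c]; rewrite in_setX => /andP[/= gh /FP Cc] ->.
  have Cp v : power_hom c v \in C by apply: group_prod => i _; rewrite groupX ?Cc.
  have Cg := homs_mem (A := [set: T]%G) gh.
  apply/homsP; split=> [s _|s u _ _|s]; rewrite ?inE // !ffunE /=.
    by rewrite groupM.
  rewrite (homsM (A := [set: T]%G) gh) ?inE // power_homD //.
  by rewrite !mulgA -(mulgA (g s.1)) (centsP cC _ (Cg _) _ (Cp _)) mulgA.
move=> [g c] [g' c']; rewrite !in_setX => /andP[/= gh /FP Cc] /andP[/= gh' /FP Cc'].
move=> /ffunP ephi.
have p0 d : (forall i, d i \in C) -> power_hom d 0%R = 1.
  by move=> Cd; rewrite /power_hom big1 // => i _; rewrite mxE expg0.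
have pd d i : (forall i, d i \in C) -> power_hom d (delta_mx ord0 i) = d i.
  move=> Cd; rewrite /power_hom.
  rewrite (eq_bigr (fun j => if j == i then d j else 1)) => [|j _].
    by rewrite -big_mkcond big_pred1_eq.
  by rewrite mxE eqxx /=; case: eqP => //= _; rewrite expg1.
congr (_, _); apply/ffunP.
  by move=> t; have := ephi (t, 0%R); rewrite !ffunE /= !p0 // !mulg1.
move=> i; have := ephi (0%R, delta_mx ord0 i); rewrite !ffunE /= !pd //.
by rewrite (homs1 (A := [set: T]%G) gh) (homs1 (A := [set: T]%G) gh') !mul1g.
Qed.

End FreeSource.

(** * Automorphisms, and epimorphisms onto a primary component *)

Section HallCount.
Local Open Scope group_scope.

Lemma card_Aut_epis (gT : finGroupType) :
  #|Aut [set: gT]| = #|epis [set: gT] [set: gT]|.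
Proof.
pose phi (a : {perm gT}) : {ffun gT -> gT} := [ffun x => a x].
rewrite -(card_imset (mem (Aut [set: gT])) (f := phi)); last first.
  by move=> a b /ffunP e; apply/permP=> x; have := e x; rewrite !ffunE.
congr #|pred_of_set _|; apply/setP=> f; apply/imsetP/idP.
  case=> a /Aut_morphic/morphicP aM ->; apply/setIdP; split.
    by apply/homsP; split=> [x|x y Ax Ay|x]; rewrite ?inE // !ffunE aM.
  apply/subsetP=> y _; apply/imsetP; exists (a^-1 y); rewrite ?inE //.
  by rewrite ffunE permKV.
case/setIdP=> fh fs.
have finj : injective f.
  have /imset_injP fI : #|f @: [set: gT]| == #|[set: gT]|.
    by rewrite eqn_leq subset_leq_card ?subsetT // subset_leq_card.
  by move=> x y; apply: fI; rewrite inE.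
exists (perm finj); last by apply/ffunP=> x; rewrite ffunE permE.
rewrite inE; apply/andP; split; first by apply/subsetP=> x; rewrite inE.
apply/morphicP=> x y Ax Ay; rewrite !permE.
exact: (homsM (A := [set: gT]%G) fh).
Qed.

Lemma card_epis_hall (gT rT : finGroupType) (A : {group gT}) (p n : nat) (tau : seq nat) :
  abelian [set: rT] -> prime p ->
  (forall z : rT, p.-elt z -> #|homs A <[z]>| = hom_count p n tau (logn p #[z])) ->
  (#|epis A 'O_p([set: rT])|%:R =
   epi_count p (hom_count p n tau) (ptype p (torsion_part p rT)) :> rat)%R.
Proof.
move=> cR p_pr hE; have cO := abelianS (pcore_sub p [set: rT]) cR.
have pO := pcore_pgroup p [set: rT].
rewrite torsion_part_pcore //.
have [srt ge1 [b defO ob]] := ptypeP p_pr cO pO.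
have lamE : [seq logn p #[x] | x <- b] = ptype p 'O_p([set: rT]).
  rewrite (map_comp (logn p) (fun x : rT => #[x])) ob -map_comp.
  by rewrite -[RHS]map_id; apply: eq_map => k /=; rewrite pfactorK.
rewrite -lamE in srt *; rewrite /epi_count size_map.
apply: card_epis_basis srt hE => // x xb; rewrite -order_eq1.
have : #[x] \in [seq (p ^ k)%N | k <- ptype p 'O_p([set: rT])].
  by rewrite -ob; apply: map_f.
case/mapP=> k kl ->; have := allP ge1 k kl.
by case: k {kl} => // k _; rewrite expnS muln_eq1 negb_and gtn_eqF ?prime_gt1.
Qed.

End HallCount.

(** * Passing from G to a finite quotient *)

Section InfiniteSource.
Local Open Scope group_scope.
Variables (G : groupType) (gT rT : finGroupType) (q : G -> gT).
Hypothesis qM : {morph q : x y / x * y}.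
Hypothesis qS : forall s, exists x, q x = s.

(** Composition with the surjective [q] is injective on functions, and its
    image consists of the morphisms that are constant on the fibers of [q]. *)
Lemma card_Epi_epis :
  (forall f : G -> rT, {morph f : x y / x * y} ->
     forall x y, q x = q y -> f x = f y) ->
  #|` fset_set (@Epi G rT)|%fset = #|epis [set: gT] [set: rT]|.
Proof.
move=> qf; pose phi (f : {ffun gT -> rT}) : G -> rT := fun x => f (q x).
have inj : injective phi.
  move=> f g e; apply/ffunP=> s; have [x <-] := qS s.
  exact: (congr1 (fun h => h x) e).
suff -> : @Epi G rT = [set` [fset phi f | f in epis [set: gT] [set: rT]]%fset]%classic.
  by rewrite set_fsetK card_imfset //= cardE.
apply/seteqP; split=> f /=.
  case=> fM fS; pose pre s := projT1 (cid (qS s)).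
  have preK s : q (pre s) = s by rewrite /pre; case: cid.
  apply/imfsetP; exists [ffun s => f (pre s)] => /=; last first.
    by apply/funext=> x; rewrite /phi ffunE; apply: qf => //; rewrite preK.
  apply/setIdP; split.
    apply/homsP; split=> [s|s u _ _|s]; rewrite ?inE // !ffunE -fM.
    by apply: qf => //; rewrite qM !preK.
  apply/subsetP=> y _; have [x _ <-] : range f y by rewrite fS.
  apply/imsetP; exists (q x); rewrite ?inE // ffunE.
  by apply: qf => //; rewrite preK.
case/imfsetP=> u /= /setIdP[uh us] ->; split.
  by move=> x y; rewrite /phi qM (homsM (A := [set: gT]%G) uh) ?inE.
apply/seteqP; split=> // y _; have /imsetP[s _ ->] := subsetP us y (in_setT y).
by have [x <-] := qS s; exists x.
Qed.

End InfiniteSource.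

Section HomologyQuotient.
Local Open Scope group_scope.

Lemma morph_derived (G : groupType) (rT : finGroupType) (f : G -> rT) :
  abelian [set: rT] -> {morph f : x y / x * y} ->
  forall x y, \pi_(H1 G)%qT x = \pi_(H1 G)%qT y -> f x = f y.
Proof.
move=> cR fM x y /pi_H1_eq D.
have f1 : f 1 = 1 by apply: (mulgI (f 1)); rewrite -fM !mulg1.
have fV z : f z^-1 = (f z)^-1 by apply: (mulgI (f z)); rewrite -fM !mulgV.
have comm (a b : rT) : a * b = b * a by apply: (centsP cR); rewrite inE.
have : f (x^-1 * y) = 1.
  have := D [set z | f z = 1]%classic; apply; split.
    split=> //= [a b fa fb|a fa]; first by rewrite fM fa fb mulg1.
    by rewrite fV fa invg1.
  move=> _ [a [b ->]] /=.
  by rewrite /commg /conjg !fM !fV (comm _ (f b)) mulKg mulVg.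
by rewrite fM fV => E; rewrite -[f y](mulKVg (f x)) E mulg1.
Qed.

Variables (G : groupType) (n : nat) (T : finZmodType).
Variable iota : {additive H1 G -> ('rV[int]_n * T)%type}.
Hypothesis iotaB : bijective iota.
Variable e : nat.
Hypothesis e1 : (1 < e)%N.

Definition homology_mod (x : G) : T * 'rV['Z_e]_n :=
  let a := iota (\pi_(H1 G)%qT x) in (a.2, map_mx intr a.1).

Lemma pi_H1_addE (x y : G) :
  (\pi_(H1 G)%qT (x * y)%g = \pi_(H1 G)%qT x + \pi_(H1 G)%qT y)%R.
Proof. by rewrite -pi_H1_mul. Qed.

Lemma homology_modM : {morph homology_mod : x y / x * y}.
Proof.
by move=> x y; rewrite /homology_mod pi_H1_addE raddfD /= map_mxD.
Qed.

Lemma pi_H1_surj a : exists x : G, iota (\pi_(H1 G)%qT x) = a.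
Proof.
have [j ij ji] := iotaB; exists (generic_quotient.repr (j a)).
by rewrite reprK ji.
Qed.

Lemma homology_mod_surj s : exists x, homology_mod x = s.
Proof.
have [x ex] := pi_H1_surj (map_mx (fun k : 'Z_e => Posz k) s.2, s.1).
exists x; rewrite /homology_mod ex; case: s {ex} => t v /=; congr (_, _).
by apply/matrixP=> i j; rewrite !mxE -[RHS]natr_Zp.
Qed.

Lemma intr_Zp_eq0 (m : int) : (m%:~R = 0 :> 'Z_e)%R -> exists w, m = (w * Posz e)%R.
Proof.
have H k : (k%:R = 0 :> 'Z_e)%R -> exists w, k = (w * e)%N.
  move=> /(congr1 (fun z : 'Z_e => nat_of_ord z)); rewrite /= val_Zp_nat // => /eqP.
  by move=> /dvdnP.
case: m => k /=; first by case/H=> w ->; exists (Posz w).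
rewrite NegzE rmorphN /= => /eqP; rewrite oppr_eq0 => /eqP /H[w ->].
by exists (- (Posz w))%R; rewrite mulNr.
Qed.

(** Elements [x] and [y] with the same image differ in [H_1(G)] by [e] times some
    class, hence [f x] and [f y] differ by an [e]-th power, which is trivial. *)
Lemma morph_homology_mod (rT : finGroupType) (f : G -> rT) :
  abelian [set: rT] -> (forall c : rT, c ^+ e = 1) ->
  {morph f : x y / x * y} ->
  forall x y, homology_mod x = homology_mod y -> f x = f y.
Proof.
move=> cR Re fM x y [e2 eM].
have f1 : f 1 = 1 by apply: (mulgI (f 1)); rewrite -fM !mulg1.
set a := iota (\pi_(H1 G)%qT x) in e2 eM; set b := iota (\pi_(H1 G)%qT y) in e2 eM.
have [w wE] : exists w : 'rV[int]_n, (a.1 = b.1 + w *+ e)%R.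
  have H j : exists z : int, (a.1 ord0 j - b.1 ord0 j = z * Posz e)%R.
    apply: intr_Zp_eq0; rewrite rmorphB /=.
    by move/matrixP/(_ ord0 j): eM; rewrite !mxE => ->; rewrite subrr.
  exists (\row_j projT1 (cid (H j)))%R; apply/rowP=> j; rewrite !mxE mulmxnE mxE.
  case: cid => z /= ez; rewrite -[(_ *+ e)%R]mulr_natr natz -ez addrC subrK //.
have [z ez] := pi_H1_surj (w, 0%R).
have -> : f x = f (y * z ^+ e).
  apply: morph_derived => //; apply: (bij_inj iotaB).
  rewrite pi_H1_addE raddfD /= -/a -/b.
  have -> : iota (\pi_(H1 G)%qT (z ^+ e)) = (w *+ e, 0)%R.
    elim: (e) => [|k IH].
      rewrite mulr0n; have -> : \pi_(H1 G)%qT 1 = 0%R by [].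
      by rewrite raddf0.
    by rewrite expgS pi_H1_addE raddfD /= IH ez mulrS; congr (_, _); rewrite /= addr0.
  by case: a b e2 wE {eM} => [a1 a2] [b1 b2] /= -> ->; congr (_, _); rewrite /= addr0.
have fX k : f (z ^+ k) = f z ^+ k by elim: k => // k IH; rewrite !expgS fM IH.
by rewrite fM fX Re mulg1.
Qed.

End HomologyQuotient.

(** * The Hall invariant *)

Theorem theorem3p1 (G : groupType) (Gamma : finGroupType) (n : nat)
    (T : finZmodType) (iota : {additive H1 G -> ('rV[int]_n * T)%type}) :
  finitely_generated G -> abelian [set: Gamma] -> bijective iota ->
  hall_invariant Gamma G =
    (\prod_(p <- primes #|Gamma|)
       hall_factor p n (ptype p (torsion_part p Gamma))
                       (ptype p (torsion_part p T)))%R.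
Proof.
move=> _ cG iotaB; pose e := (2 * #|Gamma|)%N.
have G0 : (0 < #|Gamma|)%N by rewrite -cardsT cardG_gt0.
(* The factor 2 keeps e > 1 when Gamma is trivial, as 'Z_e needs. *)
have e1 : (1 < e)%N by rewrite /e; lia.
have Ge (c : Gamma) : (c ^+ e = 1)%g.
  by rewrite /e mulnC expgM -cardsT expg_cardG ?inE // expg1n.
have cT : abelian [set: T] := FinRing.zmod_abelian _.
have qf f : {morph f : x y / (x * y)%g} -> _ :=
  @morph_homology_mod G n T iota iotaB e e1 Gamma f cG Ge.
rewrite /hall_invariant card_Aut_epis.
rewrite (card_Epi_epis (homology_modM iota e)
           (@homology_mod_surj _ _ _ _ iotaB e) qf).
rewrite !(card_epis_primary _ cG) cardsT !natr_prod -prodf_div.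
apply: eq_big_seq => p; rewrite mem_primes => /and3P[p_pr _ _].
have source_count (z : Gamma) : (p.-elt z)%g ->
    #|homs [set: T * 'rV['Z_e]_n] <[z]>%g| =
      hom_count p n (ptype p (torsion_part p T)) (logn p #[z]%g).
  move=> pz; rewrite (card_homs_source (C := <[z]>%G) T n e1 (cycle_abelian z)).
    rewrite (card_homs_to_pcycle cT p_pr pz) -orderE /hom_count expnD mulnC expnM.
    by rewrite -p_part part_pnat_id.
  by move=> c _; rewrite order_dvdn Ge.
have target_count (z : Gamma) : (p.-elt z)%g ->
    #|homs [set: Gamma] <[z]>%g| =
      hom_count p 0 (ptype p (torsion_part p Gamma)) (logn p #[z]%g).
  move=> pz; rewrite (card_homs_to_pcycle cG p_pr pz).
  by rewrite /hom_count muln0 add0n.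
rewrite (card_epis_hall cG p_pr source_count) (card_epis_hall cG p_pr target_count).
have [srt ge1 _] := ptypeP p_pr (abelianS (pcore_sub p _) cG) (pcore_pgroup p [set: Gamma]).
rewrite /= -torsion_part_pcore // in srt ge1.
by rewrite epi_count_numerator // epi_count_denominator // prime_gt0.
Qed.
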